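(* There exists an unweighted directed graph $G$ of order $n$ such that $G$ has only one vertex $v$ with forward paths (directed paths from $v$) to all other vertices and $\operatorname{ept}_{\mathrm{rzf}}(G,v)=\Omega(n^2)$. That is, there is a constant $c>0$ such that for all sufficiently large $n$ there is an unweighted directed graph $G$ of order $n$ having exactly one vertex $v$ from which every other vertex is reachable by a directed path, and satisfying $\operatorname{ept}_{\mathrm{rzf}}(G,v)\ge cn^2$.
   Context: Directed graphs are finite, without loops or multiple edges (edges in both directions between two vertices are allowed). The order is the number of vertices. Randomized zero forcing (RZF) on an unweighted directed graph $G$: start with blue set $B_0$. Given the blue set $B_t$, each white vertex $w\notin B_t$ independently becomes blue at round $t+1$ with probability equal to (number of in-neighbors of $w$ in $B_t$)/(indegree of $w$), and with probability $0$ if $w$ has indegree $0$; blue vertices stay blue forever. $\operatorname{ept}_{\mathrm{rzf}}(G,v)$ is the expected value of $\tau=\min\{t: B_t=V(G)\}$ started from $B_0=\{v\}$ if it is possible to color all of $G$ blue from $\{v\}$, and $\infty$ otherwise. *)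

(* Defs.v *)
From HB Require Import structures.
From mathcomp Require Import all_boot all_order all_algebra.
From mathcomp Require Import all_classical all_reals all_analysis.

Set Implicit Arguments.
Unset Strict Implicit.
Unset Printing Implicit Defensive.

Import Order.TTheory GRing.Theory Num.Theory.

Local Open Scope ring_scope.

(* A finite directed graph without loops or multiple edges is an irreflexive
   relation [e] on a finType; [e u w] means that there is an edge u -> w. *)

Definition in_nbrs (V : finType) (e : rel V) (w : V) : {set V} :=
  [set u | e u w].

(* When [w] has indegree 0 this is 0 / 0, which MathComp evaluates to 0. *)
Definition rzf_vertex_prob (R : realType) (V : finType) (e : rel V)
    (B : {set V}) (w : V) : R :=
  #|in_nbrs e w :&: B|%:R / #|in_nbrs e w|%:R.

(* One-round transition probability from [B] to [B']: blue vertices stay blue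
   and the white ones turn blue independently of each other. *)
Definition rzf_step (R : realType) (V : finType) (e : rel V)
    (B B' : {set V}) : R :=
  if B \subset B' then
    \prod_(w | w \notin B)
      (if w \in B' then rzf_vertex_prob R e B w
       else 1 - rzf_vertex_prob R e B w)
  else 0.

Definition trajectory (V : finType) (t : nat) := {ffun 'I_t.+1 -> {set V}}.

(* P(B_0 = b 0, ..., B_t = b t) for the process started from [B0]. *)
Definition traj_prob (R : realType) (V : finType) (e : rel V) (B0 : {set V})
    (t : nat) (b : trajectory V t) : R :=
  (b ord0 == B0)%:R *
  \prod_(i < t) rzf_step R e (b (widen_ord (leqnSn t) i)) (b (lift ord0 i)).

(* The event tau = t, where tau = min {t : B_t = V}, seen on B_0, ..., B_t. *)
Definition first_full (V : finType) (t : nat) (b : trajectory V t) : bool :=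
  (b ord_max == [set: V]) &&
  [forall i : 'I_t, b (widen_ord (leqnSn t) i) != [set: V]].

Definition rzf_time_prob (R : realType) (V : finType) (e : rel V)
    (B0 : {set V}) (t : nat) : R :=
  \sum_(b : trajectory V t | first_full b) traj_prob R e B0 b.

Definition rzf_possible (R : realType) (V : finType) (e : rel V)
    (B0 : {set V}) : Prop :=
  exists (t : nat) (b : trajectory V t),
    b ord_max = [set: V] /\ 0 < traj_prob R e B0 b.

Local Open Scope ereal_scope.

(* P(tau = oo) *)
Definition rzf_never_prob (R : realType) (V : finType) (e : rel V)
    (B0 : {set V}) : \bar R :=
  1 - \sum_(0 <= t <oo) (rzf_time_prob R e B0 t)%:E.

(* The expectation of tau, which takes values in nat together with oo; recall
   that +oo * 0 = 0 in \bar R. *)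
Definition rzf_time_expectation (R : realType) (V : finType) (e : rel V)
    (B0 : {set V}) : \bar R :=
  \sum_(0 <= t <oo) (t%:R * rzf_time_prob R e B0 t)%:E
  + +oo * rzf_never_prob R e B0.

Definition ept_rzf (R : realType) (V : finType) (e : rel V) (v : V) : \bar R :=
  if `[< rzf_possible R e [set v] >] then rzf_time_expectation R e [set v]
  else +oo.

Definition reaches_all_others (V : finType) (e : rel V) (v : V) : Prop :=
  forall w : V, w != v -> connect e v w.

(* Main.v *)
Require Import Defs.
From HB Require Import structures.
From mathcomp Require Import all_boot all_order all_algebra.
From mathcomp Require Import all_classical all_reals all_analysis.
From mathcomp Require Import ring lra zify.

(* Take the path 0 -> 1 -> ... -> m with all the backward edges u -> w,
   0 < w < u, added; only the vertex 0, of indegree 0, reaches all others.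
   Started from {0}, the blue set is always an initial segment. When k vertices
   are white, the next one has indegree k and a single blue in-neighbour, so it
   turns blue after k rounds on average, and E tau = h m for
   h k = k + (k - 1) + ... + 1 = 'C(k + 1, 2).
   To bound E tau from below without proving that tau is almost surely finite,
   we show by induction on T the truncated inequality
   E [tau; tau < T] + (T + h m) P(tau >= T) >= h k from k white vertices. With
   k = m and T = h m it gives E (min tau T) >= h m / 2. *)

Set Implicit Arguments.
Unset Strict Implicit.
Unset Printing Implicit Defensive.

Import Order.TTheory GRing.Theory Num.Theory.

Local Open Scope ring_scope.

Section RandomizedZeroForcing.
Variables (R : realType) (V : finType) (e : rel V).
Implicit Types (B : {set V}) (t T : nat).

Local Notation P := (rzf_time_prob R e).

(** * Bounds on the transition probabilities *)

Lemma rzf_vertex_prob_ge0 B w : 0 <= rzf_vertex_prob R e B w.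
Proof. by rewrite divr_ge0. Qed.

Lemma rzf_vertex_prob_le1 B w : rzf_vertex_prob R e B w <= 1.
Proof.
rewrite /rzf_vertex_prob.
(* Indegree 0 is split off: there the quotient is [0 / 0 = 0]. *)
have [->|d_gt0] := posnP #|in_nbrs e w|; first by rewrite invr0 mulr0.
by rewrite ler_pdivrMr ?ltr0n// mul1r ler_nat subset_leq_card// subsetIl.
Qed.

Lemma rzf_step_ge0 B B' : 0 <= rzf_step R e B B'.
Proof.
rewrite /rzf_step; case: ifP => // _; apply: prodr_ge0 => w _.
by case: ifP; rewrite ?subr_ge0 ?rzf_vertex_prob_le1 ?rzf_vertex_prob_ge0.
Qed.

Lemma rzf_time_prob_ge0 B t : 0 <= P B t.
Proof.
apply: sumr_ge0 => b _; rewrite mulr_ge0// prodr_ge0// => i _.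
exact: rzf_step_ge0.
Qed.

(** * Conditioning on the first round *)

Definition traj_cons t (x : {set V} * trajectory V t) : trajectory V t.+1 :=
  [ffun i => if unlift ord0 i is Some j then x.2 j else x.1].

Definition traj_uncons t (b : trajectory V t.+1) : {set V} * trajectory V t :=
  (b ord0, [ffun i => b (lift ord0 i)]).

Lemma traj_consK t : cancel (@traj_cons t) (@traj_uncons t).
Proof.
case=> B b; rewrite /traj_uncons /traj_cons ffunE unlift_none; congr (_, _).
by apply/ffunP => i; rewrite !ffunE liftK.
Qed.

Lemma traj_unconsK t : cancel (@traj_uncons t) (@traj_cons t).
Proof.
move=> b; apply/ffunP => i; rewrite ffunE /=.
by case: unliftP => [j ->|->]//; rewrite ffunE.
Qed.

Lemma widen_ord_lift0 t (i : 'I_t) :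
  widen_ord (leqnSn t.+1) (lift ord0 i) = lift ord0 (widen_ord (leqnSn t) i).
Proof. exact: val_inj. Qed.

Lemma traj_prob_cons B0 t B (b : trajectory V t) :
  traj_prob R e B0 (traj_cons (B, b)) =
  (B == B0)%:R * (rzf_step R e B (b ord0) * traj_prob R e (b ord0) b).
Proof.
have cons0 : traj_cons (B, b) ord0 = B by rewrite ffunE unlift_none.
have consS i : traj_cons (B, b) (lift ord0 i) = b i by rewrite ffunE liftK.
rewrite /traj_prob eqxx mul1r big_ord_recl consS.
have -> : widen_ord (leqnSn t.+1) ord0 = ord0 by exact: val_inj.
rewrite cons0; congr (_ * (_ * _)); apply: eq_bigr => i _.
by rewrite widen_ord_lift0 !consS.
Qed.

Lemma first_full_cons t B (b : trajectory V t) :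
  first_full (traj_cons (B, b)) = (B != [set: V]) && first_full b.
Proof.
have cons0 : traj_cons (B, b) ord0 = B by rewrite ffunE unlift_none.
have consS i : traj_cons (B, b) (lift ord0 i) = b i by rewrite ffunE liftK.
have w0 : widen_ord (leqnSn t.+1) ord0 = ord0 by exact: val_inj.
rewrite /first_full.
have -> : ord_max = lift ord0 ord_max :> 'I_t.+2 by exact: val_inj.
rewrite consS andbCA; congr (_ && _).
apply/forallP/andP => [H|[HB /forallP H] i].
  split; first by rewrite -cons0 -w0.
  by apply/forallP => i; rewrite -consS -widen_ord_lift0.
case: (unliftP ord0 i) => [j ->|->]; first by rewrite widen_ord_lift0 consS.
by rewrite w0 cons0.
Qed.

Lemma rzf_time_prob0 B : P B 0 = (B == [set: V])%:R.
Proof.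
rewrite /rzf_time_prob.
have bE (b : trajectory V 0) : b = [ffun=> b ord0].
  by apply/ffunP => i; rewrite ffunE ord1.
rewrite (reindex (fun A : {set V} => [ffun=> A] : trajectory V 0)); last first.
  by exists (fun b : trajectory V 0 => b ord0) => [A _|b _];
    rewrite ?ffunE// -bE.
rewrite (eq_bigl (pred1 [set: V])); last first.
  move=> A; rewrite /first_full ffunE /=.
  by rewrite (introT forallP) ?andbT// => -[].
by rewrite big_pred1_eq /traj_prob ffunE big_ord0 mulr1 eq_sym.
Qed.

(** Markov property, by peeling off the first set of each trajectory; tau is positive only if that
    set is not full. *)
Lemma rzf_time_probS B t :
  P B t.+1 = (B != [set: V])%:R * \sum_B' rzf_step R e B B' * P B' t.
Proof.
rewrite {1}/rzf_time_prob (reindex (@traj_cons t)); last first.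
  exists (@traj_uncons t) => x _; [exact: traj_consK|exact: traj_unconsK].
rewrite (eq_bigl (fun x : {set V} * trajectory V t =>
  (x.1 != [set: V]) && first_full x.2)); last first.
  by case=> A b; rewrite first_full_cons.
rewrite (eq_bigr (fun x : {set V} * trajectory V t => (x.1 == B)%:R *
   (rzf_step R e x.1 (x.2 ord0) * traj_prob R e (x.2 ord0) x.2))); last first.
  by case=> A b _; rewrite traj_prob_cons.
rewrite -(pair_big (fun A => A != [set: V]) (@first_full V t)
  (fun (A : {set V}) (b : trajectory V t) =>
  (A == B)%:R * (rzf_step R e A (b ord0) * traj_prob R e (b ord0) b))) /=.
rewrite big_mkcond (bigD1 B)//= [X in _ + X]big1 ?addr0; last first.
  move=> A neAB; case: ifP => // _.
  by rewrite big1// => b _; rewrite (negbTE neAB) mul0r.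
case: ifP => _; last by rewrite mul0r.
rewrite mul1r.
(* Once the sums are exchanged, the initial indicator in [traj_prob] leaves only the term
   [B' = b ord0]. *)
under [RHS]eq_bigr do rewrite /rzf_time_prob mulr_sumr.
rewrite exchange_big; apply: eq_bigr => b _ /=.
rewrite eqxx mul1r (bigD1 (b ord0))//= big1 ?addr0// => A.
by rewrite /traj_prob eq_sym => /negbTE ->; rewrite mul0r mulr0.
Qed.

(** Any other superset of [B] contains a white vertex that has probability 0 of turning blue, so its
    transition probability vanishes. *)
Lemma rzf_step_one_active B w (f : {set V} -> R) : w \notin B ->
    (forall u, u \notin B -> u != w -> rzf_vertex_prob R e B u = 0) ->
  \sum_B' rzf_step R e B B' * f B' =
  (1 - rzf_vertex_prob R e B w) * f B + rzf_vertex_prob R e B w * f (w |: B).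
Proof.
move=> wB inactive.
have neq : w |: B != B by apply: contraNneq wB => <-; rewrite setU11.
rewrite (bigD1 B)//= (bigD1 (w |: B))//= big1 ?addr0.
  congr (_ * _ + _ * _); rewrite /rzf_step (bigD1 w)//=.
    rewrite subxx (negbTE wB) big1 ?mulr1// => u /andP[uB uw].
    by rewrite (negbTE uB) inactive// subr0.
  rewrite finset.subsetUr setU11 big1 ?mulr1// => u /andP[uB uw].
  by rewrite !inE (negbTE uB) (negbTE uw) inactive// subr0.
move=> B' /andP[neB neU]; rewrite /rzf_step.
case: ifPn => [sub|_]; last by rewrite mul0r.
have [u uB' uwB] : exists2 u, u \in B' & u \notin w |: B.
  (* A set between [B] and [w |: B] is one of the two, according to whether it contains [w]. *)
  apply/fintype.subsetPn/negP => sub'; move: neB.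
  rewrite finset.eqEsubset sub andbT => nsub.
  have wB' : w \in B'.
    apply: contraNT nsub => wB'; apply/fintype.subsetP => x xB'.
    have := fintype.subsetP sub' _ xB'; rewrite !inE => /orP[/eqP xw|//].
    by rewrite -xw xB' in wB'.
  by rewrite finset.eqEsubset sub' finset.subUset finset.sub1set wB' sub in neU.
move: uwB; rewrite !inE negb_or => /andP[uw uB].
by rewrite (bigD1 u)//= uB' inactive// !mul0r.
Qed.

(** * Truncated quantities P(tau < T) and E [tau; tau < T] *)

Definition rzf_cdf B T : R := \sum_(t < T) P B t.
Definition rzf_partial_mean B T : R := \sum_(t < T) t%:R * P B t.

Lemma rzf_cdf_full T : rzf_cdf [set: V] T.+1 = 1.
Proof.
rewrite /rzf_cdf big_ord_recl rzf_time_prob0 eqxx big1 ?addr0// => t _.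
by rewrite rzf_time_probS eqxx mul0r.
Qed.

Lemma rzf_partial_mean_full T : rzf_partial_mean [set: V] T = 0.
Proof.
rewrite /rzf_partial_mean big1// => -[[|t] ?] _ /=; first by rewrite mul0r.
by rewrite rzf_time_probS eqxx mul0r mulr0.
Qed.

Section OneActive.
Variables (B : {set V}) (w : V).
Hypothesis wB : w \notin B.
Hypothesis inactive :
  forall u, u \notin B -> u != w -> rzf_vertex_prob R e B u = 0.

Let p := rzf_vertex_prob R e B w.

Let B_not_full : B != [set: V].
Proof. by apply: contraNneq wB => ->; rewrite inE. Qed.

Let P0 : P B 0 = 0. Proof. by rewrite rzf_time_prob0 (negbTE B_not_full). Qed.

Let PS t : P B t.+1 = (1 - p) * P B t + p * P (w |: B) t.
Proof.
by rewrite rzf_time_probS B_not_full mul1r (rzf_step_one_active _ wB inactive).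
Qed.

Lemma rzf_cdf_one_active T :
  rzf_cdf B T.+1 = (1 - p) * rzf_cdf B T + p * rzf_cdf (w |: B) T.
Proof.
rewrite /rzf_cdf big_ord_recl P0 add0r !mulr_sumr -big_split.
by apply: eq_bigr => t _; exact: PS.
Qed.

(** The round just spent adds 1 to tau, which contributes the [rzf_cdf] terms. *)
Lemma rzf_partial_mean_one_active T : rzf_partial_mean B T.+1 =
  (1 - p) * (rzf_partial_mean B T + rzf_cdf B T) +
  p * (rzf_partial_mean (w |: B) T + rzf_cdf (w |: B) T).
Proof.
rewrite /rzf_partial_mean /rzf_cdf big_ord_recl P0 mulr0 add0r -!big_split.
rewrite !mulr_sumr -big_split; apply: eq_bigr => t _ /=.
by rewrite PS /bump/= natrD; ring.
Qed.

End OneActive.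

(* The left-hand side is [E (min tau T)]. *)
Lemma le_rzf_time_expectation B T : (forall T', rzf_cdf B T' <= 1) ->
  ((rzf_partial_mean B T + T%:R * (1 - rzf_cdf B T))%:E
   <= rzf_time_expectation R e B)%E.
Proof.
move=> cdf_le1; rewrite /rzf_time_expectation /rzf_never_prob.
have Pge0 t : (0 <= (P B t)%:E)%E by rewrite lee_fin rzf_time_prob_ge0.
have tPge0 t : (0 <= (t%:R * P B t)%:E)%E.
  by rewrite lee_fin mulr_ge0// rzf_time_prob_ge0.
have mean_ge0 : (0 <= \sum_(0 <= t <oo) (t%:R * P B t)%:E)%E.
  by apply: nneseries_ge0.
set S := (\sum_(0 <= t <oo) (P B t)%:E)%E.
have Sle1 : (S <= 1)%E.
  apply: lime_le; first exact: is_cvg_nneseries.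
  by apply: nearW => n; rewrite sumEFin lee_fin big_mkord; exact: cdf_le1.
(* If the total mass is below 1, tau is infinite with positive probability and the expectation is
   [+oo]. *)
have [Slt1|] := ltP S 1%E.
  rewrite gt0_mulye ?sube_gt0// addey ?leey//.
  by rewrite gt_eqF// (lt_le_trans _ mean_ge0).
(* Otherwise [1 - rzf_cdf B T] is the tail mass from [T] on, where each weight [t] is at least
   [T]. *)
move=> Sge1; have S1 : S = 1%E by apply/eqP; rewrite eq_le Sle1.
rewrite S1 subee// mule0 adde0.
rewrite (@nneseries_split _ _ 0 T)//= add0n sumEFin big_mkord EFinD.
apply: leeD => //.
have : (1 - (rzf_cdf B T)%:E = \sum_(T <= t <oo) (P B t)%:E)%E.
  rewrite -S1 /S (@nneseries_split _ _ 0 T)// add0n sumEFin big_mkord.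
  by rewrite addeAC subee// add0e.
rewrite EFinM EFinB => ->.
rewrite -nneseriesZl//; apply: lee_lim.
- by apply: is_cvg_nneseries => t _ _; rewrite mule_ge0// lee_fin.
- by apply: is_cvg_nneseries.
apply: nearW => n; rewrite [leLHS]big_nat [leRHS]big_nat.
apply: lee_sum => t /andP[Tt _].
by rewrite lee_fin ler_wpM2r ?rzf_time_prob_ge0// ler_nat.
Qed.

End RandomizedZeroForcing.

(** * The path with all backward edges *)

Definition back_path (m : nat) : rel 'I_m.+1 :=
  fun u w => (u.+1 == w)%N || (0 < w < u)%N.

Definition prefix_set (m i : nat) : {set 'I_m.+1} :=
  [set w : 'I_m.+1 | (w <= i)%N].

Section BackPath.
Variables (R : realType) (m : nat).
Local Notation e := (@back_path m).
Local Notation B := (prefix_set m).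

Lemma back_path_irreflexive : irreflexive e.
Proof. by move=> u; rewrite /back_path; lia. Qed.

Lemma back_path_connect (w : 'I_m.+1) : connect e ord0 w.
Proof.
case: w => i; elim: i => [|i IHi] im.
  by rewrite (_ : Ordinal im = ord0) ?connect0//; exact: val_inj.
apply: connect_trans (IHi (ltnW im)) (connect1 _).
by rewrite /back_path /= eqxx.
Qed.

Lemma back_path_no_edge_to0 u : e u ord0 = false.
Proof. by []. Qed.

Lemma back_path_unique_root : unique (reaches_all_others e) ord0.
Proof.
split=> [w _|v reach]; first exact: back_path_connect.
apply/eqP; apply: contraT => v0; have /connectP[p] := reach _ v0.
(* A path from [v != ord0] to [ord0] is nonempty, and its last edge would enter [ord0]. *)
case/lastP: p => [_ /eqP|p u]; first by rewrite (negbTE v0).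
rewrite rcons_path last_rcons => /andP[_ pu] u0.
by rewrite -u0 back_path_no_edge_to0 in pu.
Qed.

(** The in-neighbours are [w - 1] and the [m - w] vertices above [w]. *)
Lemma card_in_nbrs_back_path (w : 'I_m.+1) :
  (0 < w)%N -> #|in_nbrs e w| = (m.+1 - w)%N.
Proof.
move=> w0; have pm : (w.-1 < m.+1)%N by have := ltn_ord w; lia.
have -> : in_nbrs e w = Ordinal pm |: [set u : 'I_m.+1 | (w < u)%N].
  by apply/setP => u; rewrite !inE /back_path -val_eqE /=; lia.
rewrite cardsU1 inE /= -sum1dep_card.
rewrite -(big_mkord (fun u => w < u)%N (fun=> 1%N)).
rewrite -(@big_nat_widenl _ _ _ w.+1 0 _ xpredT)//.
by rewrite sum_nat_const_nat; have := ltn_ord w; lia.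
Qed.

Lemma prefix_full : B m = [set: 'I_m.+1].
Proof. by apply/setP => u; rewrite !inE -ltnS ltn_ord. Qed.

Lemma prefix0 : B 0 = [set ord0].
Proof. by apply/setP => u; rewrite !inE leqn0 -val_eqE. Qed.

Lemma prefix_setS (w : 'I_m.+1) (i : nat) :
  w = i.+1 :> nat -> w |: B i = B i.+1.
Proof. by move=> wi; apply/setP => u; rewrite !inE -val_eqE /= wi; lia. Qed.

Lemma rzf_vertex_prob_next (w : 'I_m.+1) (i : nat) : w = i.+1 :> nat ->
  rzf_vertex_prob R e (B i) w = (m - i)%:R^-1.
Proof.
move=> wi; rewrite /rzf_vertex_prob card_in_nbrs_back_path ?wi// subSS.
have im : (i < m.+1)%N by have := ltn_ord w; lia.
have -> : in_nbrs e w :&: B i = [set Ordinal im].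
  by apply/setP => u; rewrite !inE /back_path -val_eqE /= wi; lia.
by rewrite cards1 mul1r.
Qed.

(** All in-neighbours, [w - 1] and the vertices above [w], exceed [i] and are white. *)
Lemma rzf_vertex_prob_later (w : 'I_m.+1) (i : nat) : (i.+1 < w)%N ->
  rzf_vertex_prob R e (B i) w = 0.
Proof.
move=> iw; rewrite /rzf_vertex_prob.
have -> : in_nbrs e w :&: B i = finset.set0.
  by apply/setP => u; rewrite !inE /back_path; lia.
by rewrite cards0 mul0r.
Qed.

(** * Recursion in the number of white vertices *)

Section Next.
Variables (k : nat) (km : (k < m)%N).
Let i := (m - k.+1)%N.
Let w : 'I_m.+1 := inord i.+1.
Let wE : w = i.+1 :> nat. Proof. by rewrite inordK// /i; lia. Qed.
Let wB : w \notin B i. Proof. by rewrite inE wE; lia. Qed.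
Let inactive u : u \notin B i -> u != w -> rzf_vertex_prob R e (B i) u = 0.
Proof.
rewrite inE -val_eqE /= wE => ui uw.
by apply: rzf_vertex_prob_later; lia.
Qed.
Let UE : w |: B i = B (m - k).
Proof. by rewrite (prefix_setS wE) /i; congr B; lia. Qed.
Let pE : rzf_vertex_prob R e (B i) w = k.+1%:R^-1.
Proof. by rewrite (rzf_vertex_prob_next wE) /i; congr (_%:R^-1); lia. Qed.

Lemma rzf_cdf_back_path T : rzf_cdf R e (B (m - k.+1)) T.+1 =
  (1 - k.+1%:R^-1) * rzf_cdf R e (B (m - k.+1)) T +
  k.+1%:R^-1 * rzf_cdf R e (B (m - k)) T.
Proof. by rewrite (rzf_cdf_one_active wB inactive) UE pE. Qed.

Lemma rzf_partial_mean_back_path T :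
  rzf_partial_mean R e (B (m - k.+1)) T.+1 =
  (1 - k.+1%:R^-1) * (rzf_partial_mean R e (B (m - k.+1)) T +
                      rzf_cdf R e (B (m - k.+1)) T) +
  k.+1%:R^-1 * (rzf_partial_mean R e (B (m - k)) T +
                rzf_cdf R e (B (m - k)) T).
Proof. by rewrite (rzf_partial_mean_one_active wB inactive) UE pE. Qed.

End Next.

(** By induction on [T]: each round gives a convex combination of two values at most 1. *)
Lemma rzf_cdf_back_path_le1 T k : (k <= m)%N ->
  rzf_cdf R e (B (m - k)) T <= 1.
Proof.
elim: T k => [|T IH] [|k] km; rewrite ?[rzf_cdf _ _ _ 0]big_ord0 ?ler01//.
  by rewrite subn0 prefix_full rzf_cdf_full.
rewrite rzf_cdf_back_path//.
have q0 : 0 <= k.+1%:R^-1 :> R by rewrite invr_ge0.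
have q1 : k.+1%:R^-1 <= 1 :> R by rewrite invf_le1// ler1n.
move: (k.+1%:R^-1) (IH k.+1 km) (IH k (ltnW km)) q0 q1 => q.
move: (rzf_cdf _ _ _ _) (rzf_cdf _ _ _ _) => x y; nra.
Qed.

(* [ 'C(k.+1, 2) ] is the expected time to colour the last [k] vertices. *)
Lemma rzf_partial_mean_back_path_ge T k (H : R) : (k <= m)%N ->
    'C(m.+1, 2)%:R <= H ->
  'C(k.+1, 2)%:R <= rzf_partial_mean R e (B (m - k)) T
                    + (T%:R + H) * (1 - rzf_cdf R e (B (m - k)) T).
Proof.
move=> + leH; elim: T k => [|T IH] k km.
  (* At [T = 0] the right-hand side is [H], at least h m and hence at least h k. *)
  rewrite [rzf_cdf _ _ _ 0]big_ord0 [rzf_partial_mean _ _ _ 0]big_ord0.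
  rewrite subr0 mulr1 !add0r (le_trans _ leH)// ler_nat.
  by rewrite leq_bin2l.
case: k km => [|k] km.
  by rewrite subn0 prefix_full rzf_cdf_full rzf_partial_mean_full
    subrr mulr0 addr0.
rewrite rzf_cdf_back_path// rzf_partial_mean_back_path//.
have := IH k.+1 km; have := IH k (ltnW km).
(* Pascal's rule: h (k + 1) = h k + (k + 1). *)
rewrite [in 'C(k.+2, 2)]binS bin1 natrD -[T.+1]addn1 natrD.
have k0 : k.+1%:R != 0 :> R by rewrite pnatr_eq0.
have q0 : 0 <= k.+1%:R^-1 :> R by rewrite invr_ge0.
have q1 : k.+1%:R^-1 <= 1 :> R by rewrite invf_le1// ler1n.
have qk : k.+1%:R^-1 * k.+1%:R = 1 :> R by rewrite mulVf.
move: (k.+1%:R^-1) q0 q1 qk => q q0 q1 qk.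
set a := rzf_partial_mean _ _ _ _.
set a' := rzf_partial_mean _ _ (B (m - k.+1)) _.
set f := rzf_cdf _ _ _ _.
set f' := rzf_cdf _ _ (B (m - k.+1)) _.
(* The right-hand side is 1 plus the average, with weights [q] and [1 - q], of those for [k] and
   [k.+1] at [T]. As [q * k.+1 = 1], also h (k + 1) = 1 + q h k + (1 - q) h (k + 1). *)
move=> /(ler_wpM2l q0) h1.
have q2 : 0 <= 1 - q by rewrite subr_ge0.
move=> /(ler_wpM2l q2) h2; nra.
Qed.

Lemma rzf_time_expectation_back_path_ge :
  (('C(m.+1, 2)%:R / 2)%:E <= rzf_time_expectation R e [set ord0])%E.
Proof.
have -> : [set ord0] = B (m - m) by rewrite subnn prefix0.
apply: le_trans (le_rzf_time_expectation 'C(m.+1, 2) _); last first.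
  by move=> T; exact: rzf_cdf_back_path_le1.
have := rzf_partial_mean_back_path_ge 'C(m.+1, 2) (leqnn m) (lexx _).
rewrite lee_fin.
(* With [T = H = h], mean [x] and cdf [y], halving h <= x + 2 h (1 - y) and using 0 <= x gives h / 2
   <= x + h (1 - y). *)
have : 0 <= rzf_partial_mean R e (B (m - m)) 'C(m.+1, 2).
  by apply: sumr_ge0 => t _; rewrite mulr_ge0// rzf_time_prob_ge0.
move: (rzf_partial_mean _ _ _ _) (rzf_cdf _ _ _ _) => x y.
move: ('C(m.+1, 2)%:R : R) => h; lra.
Qed.

End BackPath.

Theorem theorem4p2 (R : realType) :
  exists c : R, 0 < c /\
  exists N : nat, forall n : nat, (N <= n)%N ->
  exists (V : finType) (e : rel V) (v : V),
    [/\ irreflexive e, #|V| = n,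
        unique (reaches_all_others e) v
      & ((c * n%:R ^+ 2)%:E <= ept_rzf R e v)%E].
Proof.
(* For n = m + 1 the bound h m / 2 is (m + 1) m / 4, which is at least n^2 / 8 once m >= 1, that is
   n >= 2. *)
exists 8^-1; split; first by rewrite invr_gt0.
exists 2%N; case=> [//|m] m1; exists 'I_m.+1, (@back_path m), ord0; split.
- exact: back_path_irreflexive.
- exact: card_ord.
- exact: back_path_unique_root.
rewrite /ept_rzf; case: ifP => _; last exact: leey.
apply: le_trans (rzf_time_expectation_back_path_ge R m).
have : 2 * 'C(m.+1, 2)%:R = m.+1%:R * m%:R :> R.
  by rewrite -!natrM; congr _%:R; rewrite -mul_bin_diag bin1.
rewrite lee_fin -[m.+1%:R]natr1; have : 1 <= m%:R :> R by rewrite ler1n.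
move: (m%:R : R) ('C(_, _)%:R : R) => x y; nra.
Qed.
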